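(* Let $G$ be an $n$-vertex graph, let $s$ be a non-negative integer and let $\varepsilon\le 2^{-5}$. Then one can delete at most $4sn\log n$ edges from $G$ so that the remaining edges may be partitioned into (edge-disjoint) graphs $G_1,\ldots,G_r$ (subgraphs of $G$) such that $\sum_{i=1}^r |G_i|\le 2n$ and each $G_i$ is an $(\varepsilon,s)$-expander.
   Context: Graphs are finite and simple; logarithms have base two and $\log^k n=(\log n)^k$. $|H|$ denotes the number of vertices of a graph $H$. For a graph $G$ and $F\subseteq E(G)$, $G-F$ is $G$ with the edges of $F$ deleted. $N_G(U)$ is the set of vertices in $V(G)\setminus U$ with a neighbour in $U$. An $n$-vertex graph $G$ is an $(\varepsilon,s)$-expander if, for every $U\subseteq V(G)$ and $F\subseteq E(G)$ with $1\le|U|\le\frac23 n$ and $|F|\le s|U|$, we have $|N_{G-F}(U)|\ge \frac{\varepsilon|U|}{\log^2 n}$. (In particular every $1$-vertex graph is trivially an $(\varepsilon,s)$-expander.) *)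

(* Defs.v *)
(* MathComp / MathComp-Analysis *)
From HB Require Import structures.
From mathcomp Require Import all_boot all_order all_algebra.
From mathcomp Require Import reals exp.

Set Implicit Arguments.
Unset Strict Implicit.
Unset Printing Implicit Defensive.

Import Order.TTheory GRing.Theory Num.Theory.
Local Open Scope ring_scope.

(* Vertices are drawn from an ambient finite type [T], so that all the subgraphs
   of a graph live in the same type as the graph itself. Edges are two-element
   sets, which makes the graph undirected, loopless and without multi-edges. *)
Record graph (T : finType) := Graph {
  vset : {set T};
  eset : {set {set T}};
  esetP : eset \subset [set e in powerset vset | #|e| == 2%N]
}.

Definition subgraph (T : finType) (H G : graph T) : bool :=
  (vset H \subset vset G) && (eset H \subset eset G).

Definition del_edges (T : finType) (G : graph T) (F : {set {set T}}) : graph T :=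
  Graph (subset_trans (subsetDl (eset G) F) (esetP G)).

Definition nbhd (T : finType) (G : graph T) (U : {set T}) : {set T} :=
  [set v in vset G :\: U | [exists u in U, [set u; v] \in eset G]].

Definition log2 (R : realType) (x : R) : R := ln x / ln 2.

(* The logarithm vanishes only when [G] has at most one vertex, in which case
   no [U] satisfies the size constraints. *)
Definition expander (R : realType) (T : finType) (eps : R) (s : nat)
    (G : graph T) : Prop :=
  forall (U : {set T}) (F : {set {set T}}),
    U \subset vset G -> F \subset eset G ->
    (1 <= #|U|)%N -> #|U|%:R <= 2 / 3 * #|vset G|%:R :> R ->
    (#|F| <= s * #|U|)%N ->
    eps * #|U|%:R / log2 (#|vset G|%:R) ^+ 2 <= #|nbhd (del_edges G F) U|%:R.

(* Main.v *)
(** Split along a violating set. If [G] is not an expander, some [U] and [F]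
    with [|U| = u <= 2n/3], [|F| <= s u] have fewer than [eps u / log^2 n]
    neighbours [N] in [G - F]. Delete [F], put the edges meeting [U] into a graph
    on [U :|: N] and the other edges into a graph on [V :\: U], and recurse. As
    [u + |N| <= 11n/16], the logarithm of the order of the first part drops by at
    least [1/2]: this pays for the deleted edges in the potential [4 s n log n],
    and for the duplicated vertices [N] in the potential
    [n (2 - 1 / (1 + log n))], which lies between [n] and [2n]. *)
Require Import Defs.
From mathcomp Require Import all_boot all_order all_algebra.
From mathcomp Require Import reals exp.
From mathcomp Require Import ring lra.

Set Implicit Arguments.
Unset Strict Implicit.
Unset Printing Implicit Defensive.

Import Order.TTheory GRing.Theory Num.Theory.
Local Open Scope ring_scope.

(** * Base-two logarithms *)

Section Log2.
Variable R : realType.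
Implicit Types x y : R.

Lemma ln2_gt0 : 0 < ln 2 :> R.
Proof. by apply: ln_gt0; rewrite ltr1n. Qed.

Lemma ler_log2 x y : 0 < x -> x <= y -> log2 x <= log2 y.
Proof.
move=> x0 xy; rewrite /log2 ler_pM2r ?invr_gt0 ?ln2_gt0 //.
by rewrite ler_ln ?posrE // (lt_le_trans x0).
Qed.

Lemma log2_ge0 x : 1 <= x -> 0 <= log2 x.
Proof. by move=> x1; apply: divr_ge0; [apply: ln_ge0 | apply/ltW/ln2_gt0]. Qed.

Lemma log2_ge1 x : 2 <= x -> 1 <= log2 x.
Proof.
move=> x2; rewrite -[1](divff (lt0r_neq0 ln2_gt0)).
by rewrite ler_pM2r ?invr_gt0 ?ln2_gt0 // ler_ln ?posrE //; lra.
Qed.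

(** Since 2 (11/16)^2 = 242/256 < 1, the hypothesis gives 2 x^2 <= y^2; halving the logarithms gives
    the drop. *)
Lemma log2_drop x y : 0 < x -> x <= 11 / 16 * y -> log2 x <= log2 y - 1 / 2.
Proof.
move=> x0 xy; have y0 : 0 < y by lra.
have ineq : ln 2 + (ln x + ln x) <= ln y + ln y.
  rewrite -!lnM ?posrE ?mulr_gt0 //; rewrite ler_ln ?posrE ?mulr_gt0 //.
  by nra.
have l2 := ln2_gt0.
rewrite /log2 lerBrDr -(ler_pM2r l2) mulrDl !divfK ?lt0r_neq0 //.
by lra.
Qed.

End Log2.

(** * The two potentials and their behaviour under a split *)

Section Potentials.
Variable R : realType.

(** The shift by 1 keeps the denominator positive at x = 1, where the logarithm vanishes. *)
Definition order_potential (x : R) : R := x * (2 - (1 + log2 x)^-1).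

Lemma order_potential_le (x : R) : 1 <= x -> order_potential x <= 2 * x.
Proof.
move=> x1; have l0 := log2_ge0 x1; rewrite /order_potential mulrC.
rewrite ler_wpM2r ?gerBl ?invr_ge0 //; lra.
Qed.

Lemma order_potential_ge (x : R) : 1 <= x -> x <= order_potential x.
Proof.
move=> x1; have l0 := log2_ge0 x1.
have : (1 + log2 x)^-1 <= 1 by rewrite invf_le1; lra.
by rewrite /order_potential; nra.
Qed.

(** In the application [x], [u], [d] are the orders of G, U and N. From [u1] and [ux] one gets x >=
    2, so log x >= 1; [du] is the failed expansion for eps <= 1/32, with its denominator cleared. *)
Variables x u d : R.
Hypotheses (u1 : 1 <= u) (d0 : 0 <= d) (ux : u <= x - 1).
Hypotheses (u23 : u <= 2 / 3 * x) (du : 32 * d * log2 x ^+ 2 <= u).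

Let L1 : 1 <= log2 x. Proof. by apply: log2_ge1; move: u1 ux; lra. Qed.

Lemma overlap_small : 32 * d <= u.
Proof.
apply: le_trans du; rewrite ler_peMr ?mulr_ge0 //.
by rewrite -[1](expr1n _ 2) ler_sqr ?nnegrE //; move: L1; lra.
Qed.

Let La : 0 <= log2 (x - u) <= log2 x.
Proof. by apply/andP; split; [apply: log2_ge0|apply: ler_log2]; move: u1 ux; lra. Qed.

(** As d <= u/32, one has u + d <= (33/32)(2/3) x = (11/16) x. *)
Let Lb : 0 <= log2 (u + d) <= log2 x - 1 / 2.
Proof.
have := overlap_small; move: u1 d0 ux u23 => ? ? ? ? ?.
by apply/andP; split; [apply: log2_ge0|apply: log2_drop]; lra.
Qed.

(** The leading [u] is the cost of deleting F, per unit of s. Writing L = log x, the drop by 1/2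
    saves 2 (u + d), while counting N twice costs 4 d L <= u/8. *)
Lemma deletion_potential_split :
  u + 4 * ((u + d) * log2 (u + d)) + 4 * ((x - u) * log2 (x - u))
    <= 4 * (x * log2 x).
Proof.
move: u1 d0 ux => ? dpos ?; have /andP[a0 aL] := La; have /andP[b0 bL] := Lb.
have ha : (x - u) * log2 (x - u) <= (x - u) * log2 x by rewrite ler_wpM2l; lra.
have hb : (u + d) * log2 (u + d) <= (u + d) * (log2 x - 1 / 2).
  by rewrite ler_wpM2l; lra.
have hd : 32 * (d * log2 x) <= u.
  apply: le_trans du; rewrite -mulrA !ler_wpM2l // expr2 ler_peMl //.
  by rewrite (le_trans _ L1).
by move: ha hb hd; set A := log2 (x - u); set B := log2 (u + d); lra.
Qed.

(** With p, q, r the inverses of 1 + log at x, u + d, x - u, the right side minus the left is u (q -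
    p) + (x - u) (r - p) + d q - 2 d. Here r >= p, and u (q - p) >= u p^2 / 2 >= 4 d pays for the
    term 2 d. *)
Lemma order_potential_split :
  order_potential (u + d) + order_potential (x - u) <= order_potential x.
Proof.
move: u1 d0 ux => ? dpos ?; have /andP[a0 aL] := La; have /andP[b0 bL] := Lb.
rewrite /order_potential.
move: (log2 (x - u)) (log2 (u + d)) (log2 x) a0 aL b0 bL L1 du
  => A B L a0 aL b0 bL lL hd.
have pA : (1 + L)^-1 <= (1 + A)^-1 by rewrite lef_pV2 ?posrE; lra.
have p0 : 0 < (1 + L)^-1 by rewrite invr_gt0; lra.
have pE : (1 + L) * (1 + L)^-1 = 1 by rewrite divff //; lra.
have qE : (1 + B) * (1 + B)^-1 = 1 by rewrite divff //; lra.
have pq : (1 + L)^-1 <= (1 + B)^-1 by rewrite lef_pV2 ?posrE; lra.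
move: (1 + A)^-1 (1 + L)^-1 (1 + B)^-1 pA p0 pE qE pq => r p q pA p0 pE qE pq.
have qp : p ^+ 2 / 2 <= q - p.
  (* A difference of inverses; then L - B >= 1/2 and q >= p. *)
  have -> : q - p = (L - B) * (p * q).
    have : q * ((1 + L) * p) - p * ((1 + B) * q) = q - p by rewrite pE qE !mulr1.
    by move=> <-; ring.
  have h : p ^+ 2 <= p * q by rewrite expr2 ler_pM2l.
  have h0 : 0 <= p ^+ 2 by rewrite sqr_ge0.
  by nra.
have hdp : 8 * d <= u * p ^+ 2.
  have h : d * (1 + L) ^+ 2 <= u / 8.
    (* Holds because L >= 1. *)
    have : (1 + L) ^+ 2 <= 4 * L ^+ 2 by nra.
    by move=> /(ler_wpM2l dpos); lra.
  have := ler_wpM2r (sqr_ge0 p) h.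
  by rewrite -mulrA -exprMn pE expr1n; lra.
have h1 : 0 <= (x - u) * (r - p) by rewrite mulr_ge0; lra.
have h2 : 0 <= u * (q - p - p ^+ 2 / 2) by rewrite mulr_ge0; lra.
have h3 : 0 <= d * q by rewrite mulr_ge0 //; lra.
by lra.
Qed.

End Potentials.

(** * Splitting a graph along U after deleting F *)

Section Splitting.
Variables (T : finType) (G : graph T) (U : {set T}) (F : {set {set T}}).

Let N := nbhd (del_edges G F) U.

Lemma edgeP (e : {set T}) : e \in eset G -> e \subset vset G /\ #|e| = 2%N.
Proof.
by move=> /(subsetP (esetP G)); rewrite !inE => /andP[eG /eqP ->].
Qed.

Definition touching_edges := [set e in eset G :\: F | ~~ [disjoint e & U]].
Definition avoiding_edges := [set e in eset G :\: F | [disjoint e & U]].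

(** If an edge outside F meets U at a vertex a, its other end is in U or, being joined to a in G -
    F, in N. Intersecting with [vset G] gives a subgraph of G for arbitrary U. *)
Lemma touching_edges_subset :
  touching_edges \subset [set e in powerset (vset G :&: (U :|: N)) | #|e| == 2%N].
Proof.
apply/subsetP => e; rewrite !inE => /andP[/andP[eF eG] /pred0Pn[a /andP[/= ae aU]]].
have [eV e2] := edgeP eG; rewrite e2 eqxx andbT.
apply/subsetP => b be; rewrite !inE (subsetP eV _ be) andbT /=.
have [//|bU /=] := boolP (b \in U); apply/existsP; exists a; rewrite aU /=.
suff -> : [set a; b] = e by rewrite inE eF eG.
have ab : a != b by apply: contraNneq bU => <-.
apply/eqP; rewrite eqEcard cards2 ab e2 leqnn andbT.
by apply/subsetP => c; rewrite !inE => /orP[] /eqP ->.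
Qed.

Lemma avoiding_edges_subset :
  avoiding_edges \subset [set e in powerset (vset G :\: U) | #|e| == 2%N].
Proof.
apply/subsetP => e; rewrite !inE => /andP[/andP[eF eG] eU].
by have [eV e2] := edgeP eG; rewrite e2 eqxx subsetD eV eU.
Qed.

Definition touching_part := Graph touching_edges_subset.
Definition avoiding_part := Graph avoiding_edges_subset.

Lemma touching_part_subgraph : subgraph touching_part G.
Proof.
rewrite /subgraph /= subsetIl; apply/subsetP => e.
by rewrite !inE => /andP[/andP[]].
Qed.

Lemma avoiding_part_subgraph : subgraph avoiding_part G.
Proof.
rewrite /subgraph /= subsetDl; apply/subsetP => e.
by rewrite !inE => /andP[/andP[]].
Qed.

Lemma parts_disjoint : [disjoint eset touching_part & eset avoiding_part].
Proof.
rewrite -setI_eq0; apply/eqP/setP => e; rewrite !inE.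
by case: [disjoint e & U]; rewrite /= !(andbF, andFb).
Qed.

Lemma card_touching_part : U \subset vset G ->
  #|vset touching_part| = (#|U| + #|N|)%N.
Proof.
move=> UG; rewrite /= setIUr (setIidPr UG).
have NG : N \subset vset G :\: U by apply/subsetP => v; rewrite inE => /andP[].
rewrite (setIidPr (subset_trans NG (subsetDl _ _))).
rewrite cardsU (_ : U :&: N = set0) ?cards0 ?subn0 //.
apply/eqP; rewrite setI_eq0 disjoint_sym.
by move: NG; rewrite subsetD => /andP[].
Qed.

Lemma card_avoiding_part : U \subset vset G ->
  #|vset avoiding_part| = (#|vset G| - #|U|)%N.
Proof. by move=> UG; rewrite cardsDS. Qed.

End Splitting.

(** * Recursive decomposition into expanders *)

Lemma subgraph_trans (T : finType) (H K G : graph T) :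
  subgraph H K -> subgraph K G -> subgraph H G.
Proof.
move=> /andP[v1 e1] /andP[v2 e2].
by rewrite /subgraph (subset_trans v1 v2) (subset_trans e1 e2).
Qed.

Section Decomposition.
Variables (R : realType) (T : finType) (eps : R) (s : nat).

(** U and F range over finite types and real comparisons are boolean, so the existence of a
    violating pair is itself a boolean to case on. *)
Lemma expanderPn (G : graph T) : expander eps s G \/
  exists (U : {set T}) (F : {set {set T}}),
    [/\ U \subset vset G, F \subset eset G, (0 < #|U|)%N &
    [/\ #|U|%:R <= 2 / 3 * #|vset G|%:R :> R, (#|F| <= s * #|U|)%N &
     #|nbhd (del_edges G F) U|%:R < eps * #|U|%:R / log2 (#|vset G|%:R) ^+ 2]].
Proof.
set viol := fun p : {set T} * {set {set T}} =>
  [&& p.1 \subset vset G, p.2 \subset eset G, (0 < #|p.1|)%N,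
      #|p.1|%:R <= 2 / 3 * #|vset G|%:R :> R, (#|p.2| <= s * #|p.1|)%N &
      #|nbhd (del_edges G p.2) p.1|%:R
        < eps * #|p.1|%:R / log2 (#|vset G|%:R) ^+ 2].
have [/existsP[[U F] /and5P[/= h1 h2 h3 h4 /andP[h5 h6]]]|/existsPn noviol] :=
  boolP [exists p, viol p]; first by right; exists U, F.
left=> U F h1 h2 h3 h4 h5; rewrite leNgt; apply/negP => h6.
by have /negP := noviol (U, F); apply; rewrite /viol /= h1 h2 h3 h4 h5.
Qed.

Definition decomposition (G : graph T) (D : {set {set T}}) (k : R) : Prop :=
  exists (r : nat) (H : 'I_r -> graph T),
    [/\ forall i, subgraph (H i) G,
        \bigcup_(i < r) eset (H i) = eset G :\: D,
        forall i j, i != j -> [disjoint eset (H i) & eset (H j)],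
        (\sum_(i < r) #|vset (H i)|)%:R <= k &
        forall i, expander eps s (H i)].

Lemma decomposition_expander (G : graph T) :
  expander eps s G -> decomposition G set0 #|vset G|%:R.
Proof.
move=> exG; exists 1%N, (fun=> G); split=> //.
- by move=> _; rewrite /subgraph !subxx.
- by rewrite big_ord1 setD0.
- by move=> i j; rewrite !ord1 eqxx.
- by rewrite big_ord1.
Qed.

(** The inclusions of [D1] and [D2] ensure that the edges deleted from one part do not occur in the
    other, so the covered edges are exactly those outside the union. *)
Lemma decomposition_split (G : graph T) (U : {set T}) (F D1 D2 : {set {set T}})
    (k1 k2 : R) :
  D1 \subset eset (touching_part G U F) ->
  D2 \subset eset (avoiding_part G U F) ->
  decomposition (touching_part G U F) D1 k1 ->
  decomposition (avoiding_part G U F) D2 k2 ->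
  decomposition G (F :|: D1 :|: D2) (k1 + k2).
Proof.
move=> sD1 sD2 [r1 [H1 [sub1 cov1 dis1 sum1 ex1]]].
move=> [r2 [H2 [sub2 cov2 dis2 sum2 ex2]]].
pose H (i : 'I_(r1 + r2)) :=
  match split i with inl j => H1 j | inr j => H2 j end.
have HL i : H (lshift r2 i) = H1 i by rewrite /H (unsplitK (inl i)).
have HR i : H (rshift r1 i) = H2 i by rewrite /H (unsplitK (inr i)).
have dis12 i j : [disjoint eset (H1 i) & eset (H2 j)].
  have /andP[_ si] := sub1 i; have /andP[_ sj] := sub2 j.
  apply: disjointWl si _; apply: disjointWr sj _; exact: parts_disjoint.
exists (r1 + r2)%N, H; split.
- move=> i; rewrite /H; case: (split i) => j.
    exact: subgraph_trans (sub1 j) (touching_part_subgraph G U F).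
  exact: subgraph_trans (sub2 j) (avoiding_part_subgraph G U F).
- rewrite big_split_ord /= (eq_bigr _ (fun i _ => congr1 (@eset T) (HL i))).
  rewrite (eq_bigr _ (fun i _ => congr1 (@eset T) (HR i))) cov1 cov2.
  apply/setP => e; have := subsetP sD2 e; have := subsetP sD1 e; rewrite !inE.
  case: (e \in D1) => [/(_ isT) /andP[/andP[-> ->] /negPf ->] _|_].
    by rewrite /= ?andbF ?orbT.
  case: (e \in D2) => [/(_ isT) /andP[/andP[-> ->] ->]|_].
    by rewrite /= ?andbF ?orbT.
  by rewrite !orbF /=; case: [disjoint e & U]; rewrite /= ?andbT ?andbF ?orbF.
- move=> i j; rewrite /H; case: splitP => i' hi; case: splitP => j' hj ij //.
  + by apply: dis1; apply: contra ij => /eqP ij; rewrite -val_eqE /= hi hj ij.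
  + by rewrite disjoint_sym.
  + by apply: dis2; apply: contra ij => /eqP ij; rewrite -val_eqE /= hi hj ij.
- rewrite big_split_ord /= natrD lerD //.
    by rewrite (eq_bigr _ (fun i _ => congr1 (fun K => #|vset K|) (HL i))).
  by rewrite (eq_bigr _ (fun i _ => congr1 (fun K => #|vset K|) (HR i))).
- by move=> i; rewrite /H; case: (split i).
Qed.

Hypothesis eps_small : eps <= 2 ^- 5.

(** Strong induction on the order. The total order is bounded by the potential, not by 2n, because
    the potential absorbs the vertices duplicated by a split. *)
Lemma decomposition_exists (G : graph T) : (0 < #|vset G|)%N ->
  exists D : {set {set T}},
    [/\ D \subset eset G,
        #|D|%:R <= 4 * s%:R * #|vset G|%:R * log2 (#|vset G|%:R : R) &
        decomposition G D (order_potential (R := R) #|vset G|%:R)].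
Proof.
have [m] := ubnP #|vset G|; elim: m G => // m IH G; rewrite ltnS => Gm G0.
have [exG|[U [F [UG FG U0 [U23 Fs small]]]]] := expanderPn G.
  have G1 : 1 <= #|vset G|%:R :> R by rewrite ler1n.
  exists set0; split; first exact: sub0set.
    rewrite cards0; apply: mulr_ge0; last exact: log2_ge0.
    by rewrite !mulr_ge0.
  have [r [H [? ? ? sum ?]]] := decomposition_expander exG.
  exists r, H; split=> //; apply: le_trans sum _; exact: order_potential_ge.
set N := nbhd (del_edges G F) U in small.
set n := #|vset G| in Gm G0 U23 small *.
have UnR : #|U|%:R < n%:R :> R.
  by move: G0; rewrite -(ltr0n R) => ?; lra.
have Un : (#|U| < n)%N by rewrite -(ltr_nat R).
have U1 : 1 <= #|U|%:R :> R by rewrite ler1n.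
have Un1 : #|U|%:R <= n%:R - 1 :> R by rewrite lerBrDr natr1 ler_nat.
(* Here 1 <= |U| <= n - 1 forces n >= 2, so the denominator in the violated inequality can be
   cleared. *)
have L1 : 1 <= log2 (n%:R : R) by apply: log2_ge1; lra.
have N32 : 32 * #|N|%:R * log2 (n%:R : R) ^+ 2 <= #|U|%:R.
  have L0 : 0 < log2 (n%:R : R) ^+ 2 by rewrite exprn_gt0 // (lt_le_trans _ L1).
  move: small; rewrite ltr_pdivlMr // => /ltW.
  have : eps * #|U|%:R <= 2 ^- 5 * #|U|%:R by rewrite ler_wpM2r.
  by lra.
have c1 := card_touching_part F UG; rewrite -/N in c1.
have c2 := card_avoiding_part F UG; rewrite -/n in c2.
have c1R : #|vset (touching_part G U F)|%:R = #|U|%:R + #|N|%:R :> R.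
  by rewrite c1 natrD.
have c2R : #|vset (avoiding_part G U F)|%:R = n%:R - #|U|%:R :> R.
  by rewrite c2 natrB // ltnW.
have N_small := overlap_small U1 (ler0n R #|N|) Un1 N32.
have [|| D1 [sD1 cD1 dec1]] := IH (touching_part G U F).
(* The order is at most (33/32)|U| <= (11/16) n < n. *)
- apply: leq_trans Gm; rewrite -(ltr_nat R) c1R.
  by lra.
- by rewrite c1 addn_gt0 U0.
have [|| D2 [sD2 cD2 dec2]] := IH (avoiding_part G U F).
- by rewrite c2; apply: leq_trans Gm; rewrite ltn_subrL U0.
- by rewrite c2 subn_gt0.
have /andP[_ sE1] := touching_part_subgraph G U F.
have /andP[_ sE2] := avoiding_part_subgraph G U F.
exists (F :|: D1 :|: D2); split.
- by rewrite !subUset FG (subset_trans sD1 sE1) (subset_trans sD2 sE2).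
- have cD : (#|F :|: D1 :|: D2| <= s * #|U| + #|D1| + #|D2|)%N.
    apply: leq_trans (leq_card_setU _ _).1 _; rewrite leq_add2r.
    by apply: leq_trans (leq_card_setU _ _).1 _; rewrite leq_add2r.
  move: cD; rewrite -(ler_nat R) !natrD natrM => /le_trans; apply.
  rewrite c1R in cD1; rewrite c2R in cD2.
  (* Multiplying by s turns the leading |U| into s |U|, the bound on |F|. *)
  have h := deletion_potential_split U1 (ler0n R #|N|) Un1 U23 N32.
  have := ler_wpM2l (ler0n R s) h; lra.
- have [r [H [? ? ? sum ?]]] := decomposition_split sD1 sD2 dec1 dec2.
  exists r, H; split=> //; apply: le_trans sum _; rewrite c1R c2R.
  exact: order_potential_split.
Qed.

End Decomposition.

Theorem lemma14 (R : realType) (T : finType) (G : graph T) (n s : nat) (eps : R)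
    (hn : #|vset G| = n) (heps : eps <= 2 ^- 5) :
  exists D : {set {set T}},
    [/\ D \subset eset G,
        #|D|%:R <= 4 * s%:R * n%:R * log2 (n%:R : R) &
        exists (r : nat) (H : 'I_r -> graph T),
          [/\ forall i : 'I_r, subgraph (H i) G,
              \bigcup_(i < r) eset (H i) = eset (del_edges G D),
              forall i j : 'I_r, i != j -> [disjoint eset (H i) & eset (H j)],
              (\sum_(i < r) #|vset (H i)| <= 2 * n)%N &
              forall i : 'I_r, expander eps s (H i)]].
Proof.
(* The empty graph lies outside the induction; having no nonempty U, it is an expander and forms a
   single part. *)
have [n0|n_gt0] := posnP n.
  have exG : expander eps s G.
    move=> U F /subset_leq_card; rewrite hn n0 leqn0 => /eqP -> _.
    by rewrite ltnn.
  exists set0; rewrite sub0set cards0 n0 mulr0 mul0r; split=> //.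
  have [r [H [? ? ? sum ?]]] := decomposition_expander exG.
  exists r, H; split=> //; rewrite muln0 -(ler_nat R).
  by rewrite hn n0 in sum.
have G0 : (0 < #|vset G|)%N by rewrite hn.
have [D [sD cD [r [H [? ? ? sum ?]]]]] := decomposition_exists s heps G0.
rewrite hn in cD sum.
exists D; split=> //; exists r, H; split=> //.
rewrite -(ler_nat R) natrM; apply: le_trans sum _.
by apply: order_potential_le; rewrite ler1n.
Qed.
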